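(* (Inertial case) Let $m>0$, $\kappa\ge0$, $N\ge 1$, and let $\Theta(t)=(\theta_1(t),\dots,\theta_N(t))$, $t\ge0$, solve the inertial Winfree system with natural frequencies $\mathcal V=(\nu_1,\dots,\nu_N)$, coupling $\kappa$, inertia $m$, and initial data $(\Theta^0,\Omega^0)$. Define $\Phi(t)=(\varphi_1(t),\dots,\varphi_{4N}(t))$ by $$\varphi_i(t)=\theta_i(t),\quad \varphi_{N+i}(t)=-\theta_i(t),\quad \varphi_{2N+k}(t)\equiv 0,\qquad 1\le i\le N,\ 1\le k\le 2N,$$ and set $\widetilde{\mathcal V}=(\tilde\nu_1,\dots,\tilde\nu_{4N})=(\nu_1,\dots,\nu_N,-\nu_1,\dots,-\nu_N,0,\dots,0)$ (with $2N$ zeros) and $\tilde\kappa=2\kappa$. Then $\Phi$, with initial data $(\Phi^0,\dot\Phi^0)=(\Phi(0),\dot\Phi(0))$ inherited from this definition, solves the inertial Kuramoto system $$m\ddot\varphi_k+\dot\varphi_k=\tilde\nu_k+\frac{\tilde\kappa}{4N}\sum_{l=1}^{4N}\sin(\varphi_l-\varphi_k),\qquad 1\le k\le 4N.$$ (First-order case) Likewise, if $\Theta(t)$ solves the first-order Winfree system with natural frequencies $\mathcal V$, coupling $\kappa$, and initial data $\Theta^0$, then $\Phi$ defined by the same formulas, with the same $\widetilde{\mathcal V}$, $\tilde\kappa=2\kappa$, and inherited initial data $\Phi^0=\Phi(0)$, solves the first-order Kuramoto system $$\dot\varphi_k=\tilde\nu_k+\frac{\tilde\kappa}{4N}\sum_{l=1}^{4N}\sin(\varphi_l-\varphi_k),\qquad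 1\le k\le 4N.$$
   Context: The inertial Winfree system is the Cauchy problem for real-valued functions $\theta_i(t)$, $i=1,\dots,N$: $$m\ddot\theta_i+\dot\theta_i=\nu_i-\frac{\kappa}{N}\sum_{j=1}^N(1+\cos\theta_j(t))\sin\theta_i(t)\quad(t>0),\qquad (\theta_i,\dot\theta_i)(0)=(\theta_i^0,\omega_i^0),$$ with $\nu_i\in\mathbb{R}$, $\Theta^0=(\theta_1^0,\dots,\theta_N^0)$, $\Omega^0=(\omega_1^0,\dots,\omega_N^0)$. The first-order Winfree system is $$\dot\theta_i=\nu_i-\frac{\kappa}{N}\sum_{j=1}^N(1+\cos\theta_j(t))\sin\theta_i(t)\quad(t>0),\qquad \theta_i(0)=\theta_i^0.$$ Both have unique global solutions on $[0,\infty)$. *)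

(* Defs.v *)
From HB Require Import structures.
From mathcomp Require Import all_boot all_order all_algebra.
From mathcomp Require Import all_classical all_reals all_analysis.
Import Order.TTheory GRing.Theory Num.Theory.
Import numFieldNormedType.Exports.

Set Implicit Arguments.
Unset Strict Implicit.
Unset Printing Implicit Defensive.

Local Open Scope classical_set_scope.
Local Open Scope ring_scope.

(* A trajectory on [0, +oo[ is a total function R -> R whose values at negative
   times are irrelevant, so derivatives at time 0 are taken from the right. *)
Definition rquot0 (R : realType) (f : R -> R) : R -> R :=
  fun h => h^-1 * (f h - f 0).

Definition rderive0 (R : realType) (f : R -> R) : R := lim (rquot0 f @ 0^'+).

(* Solutions of x_i' = F(x)_i for t > 0, x(0) = x0, continuous on [0, +oo[. *)
Definition first_order_solution (R : realType) (n : nat)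
    (F : ('I_n -> R) -> 'I_n -> R) (x0 : 'I_n -> R) (x : 'I_n -> R -> R) : Prop :=
  [/\ forall i, derivable_oy_Rcontinuous (x i) 0,
      forall i (t : R), 0 < t -> (x i)^`()%classic t = F (x ^~ t) i
    & forall i, x i 0 = x0 i].

(* Solutions of m x_i'' + x_i' = F(x)_i for t > 0, (x, x')(0) = (x0, v0), of
   class C^1 on [0, +oo[ and twice differentiable on ]0, +oo[. *)
Definition inertial_solution (R : realType) (n : nat) (m : R)
    (F : ('I_n -> R) -> 'I_n -> R) (x0 v0 : 'I_n -> R) (x : 'I_n -> R -> R) : Prop :=
  [/\ forall i, [/\ derivable_oy_Rcontinuous (x i) 0,
                    cvg (rquot0 (x i) @ 0^'+),
                    forall t : R, 0 < t -> derivable (x i)^`()%classic t 1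
                  & (x i)^`()%classic @ 0^'+ --> rderive0 (x i)],
      forall i (t : R), 0 < t ->
        m * (x i)^`(2)%classic t + (x i)^`()%classic t = F (x ^~ t) i,
      forall i, x i 0 = x0 i
    & forall i, rderive0 (x i) = v0 i].

Definition winfree_field (R : realType) (n : nat) (nu : 'I_n -> R) (kappa : R)
    (theta : 'I_n -> R) (i : 'I_n) : R :=
  nu i - kappa / n%:R * \sum_(j < n) ((1 + cos (theta j)) * sin (theta i)).

Definition kuramoto_field (R : realType) (n : nat) (nu : 'I_n -> R) (kappa : R)
    (phi : 'I_n -> R) (k : 'I_n) : R :=
  nu k + kappa / n%:R * \sum_(l < n) sin (phi l - phi k).

Definition winfree1 (R : realType) (n : nat) (nu : 'I_n -> R) (kappa : R) :=
  first_order_solution (winfree_field nu kappa).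

Definition winfree2 (R : realType) (n : nat) (m : R) (nu : 'I_n -> R) (kappa : R) :=
  inertial_solution m (winfree_field nu kappa).

Definition kuramoto1 (R : realType) (n : nat) (nu : 'I_n -> R) (kappa : R) :=
  first_order_solution (kuramoto_field nu kappa).

Definition kuramoto2 (R : realType) (n : nat) (m : R) (nu : 'I_n -> R) (kappa : R) :=
  inertial_solution m (kuramoto_field nu kappa).

(* (x_1, ..., x_N, -x_1, ..., -x_N, 0, ..., 0) with 2N zeros. With indices from
   0, [insub k] is [Some] exactly when k < N, and when it is [None] the
   subtraction k - N is not truncated. *)
Definition lift4 (R : realType) (N : nat) (x : 'I_N -> R) (k : 'I_(4 * N)) : R :=
  if (insub (val k) : option 'I_N) is Some i then x i
  else if (insub (val k - N)%N : option 'I_N) is Some i then - x i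
  else 0.

Definition Phi (R : realType) (N : nat) (Theta : 'I_N -> R -> R)
    (k : 'I_(4 * N)) (t : R) : R :=
  lift4 (Theta ^~ t) k.

(* Main.v *)
(** The Kuramoto coupling felt by an oscillator at [p] in the configuration
    [(x, -x, 0)] is
      [sum_j (sin (x_j - p) + sin (- x_j - p)) + 2N sin (- p)
       = - 2 sin p * sum_j (1 + cos x_j)],
    which is the Winfree coupling when [p = x_i]. Every component of the lifted
    system is [c * theta_i] with [c] in [{0, 1, -1}], for which [sin] commutes
    with multiplication by [c]; the remaining equations then follow by
    scaling those of the Winfree system. *)

Require Import Defs.
From mathcomp Require Import all_boot all_order all_algebra.
From mathcomp Require Import all_classical all_reals all_analysis.
From mathcomp Require Import ring.
Import Order.TTheory GRing.Theory Num.Theory.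
Import numFieldNormedType.Exports.

Local Open Scope ring_scope.

(** The pair [i], [c] is fixed before [x], so the same pair serves the frequencies, the
    configuration and the vector field. *)
Lemma lift4_scale (R : realType) (N : nat) (k : 'I_(4 * N)) :
  exists i : 'I_N, exists2 c : R, c \in [:: 0; 1; -1] &
    forall x : 'I_N -> R, lift4 x k = c * x i.
Proof.
have N_gt0 : (0 < N)%N by case: N k => [|//]; rewrite muln0 => -[].
rewrite /lift4; case: insubP => [i _ _|_].
  by exists i, 1 => [|x]; rewrite ?inE ?eqxx ?orbT ?mul1r.
case: insubP => [i _ _|_].
  by exists i, (-1) => [|x]; rewrite ?inE ?eqxx ?orbT ?mulN1r.
(* In the zero block any oscillator will do; one exists because ['I_(4 * N)] is inhabited by [k]. *)
by exists (Ordinal N_gt0), 0 => [|x]; rewrite ?inE ?eqxx ?mul0r.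
Qed.

Lemma sum_lift4 (R : realType) (N : nat) (x : 'I_N -> R) (g : R -> R) :
  \sum_(l < 4 * N) g (lift4 x l) =
  \sum_(j < N) (g (x j) + g (- x j)) + (2 * N)%:R * g 0.
Proof.
(* Reading [lift4] on plain naturals frees the summand from the type ['I_(4 * N)], so that [4 * N]
   can be rewritten as a sum of block lengths. *)
pose f n := if (insub n : option 'I_N) is Some i then x i
  else if (insub (n - N)%N : option 'I_N) is Some i then - x i else 0.
rewrite -[LHS]/(\sum_(l < 4 * N) g (f l)).
have -> : (4 * N = N + (N + 2 * N))%N by rewrite -!mulSn.
move: (2 * N)%N => M.
rewrite !big_split_ord big_split /= addrA; congr (_ + _ + _).
- by apply: eq_bigr => j _; rewrite /f valK.
- apply: eq_bigr => j _.
  by rewrite /f addKn valK insubF // ltnNge leq_addr.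
- rewrite (eq_bigr (fun=> g 0)) => [|j _].
    by rewrite sumr_const card_ord mulr_natl.
  by rewrite /f addKn !insubF // ltnNge ?leq_addr.
Qed.

Lemma kuramoto_field_lift4 (R : realType) (N : nat) (nu : 'I_N -> R)
    (kappa : R) (x : 'I_N -> R) (k : 'I_(4 * N)) :
  kuramoto_field (lift4 nu) (2 * kappa) (lift4 x) k =
  lift4 (winfree_field nu kappa x) k.
Proof.
have [i [c c_val lift4E]] := lift4_scale R N k.
have N_neq0 : N%:R != 0 :> R.
  by rewrite pnatr_eq0; case: N i {nu x k lift4E} => [[]|].
have sin_scale : sin (c * x i) = c * sin (x i).
  by move: c_val; rewrite !inE => /or3P[] /eqP ->;
    rewrite ?mul0r ?mul1r ?mulN1r ?sin0 ?sinN.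
rewrite /kuramoto_field.
rewrite (sum_lift4 R N x (fun u => sin (u - lift4 x k))) !lift4E.
rewrite /winfree_field sub0r sinN sin_scale.
(* By the addition formula the [sin (x j)] terms of each mirrored pair cancel and the [cos (x j)]
   terms double. *)
have -> : \sum_(j < N) (sin (x j - c * x i) + sin (- x j - c * x i)) =
    - (2 * c * sin (x i)) * \sum_(j < N) cos (x j).
  rewrite mulr_sumr; apply: eq_bigr => j _.
  by rewrite !sinD !sinN !cosN sin_scale; ring.
have -> : \sum_(j < N) ((1 + cos (x j)) * sin (x i)) =
    (N%:R + \sum_(j < N) cos (x j)) * sin (x i).
  by rewrite -mulr_suml big_split /= sumr_const card_ord.
(* The zeros contribute [- 2 * N * c * sin (x i)], which supplies the [1] in [1 + cos]; the
   prefactors agree since [2 * kappa / (4 * N) * 2 = kappa / N]. *)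
by rewrite !natrM; field.
Qed.

Lemma derivable_oy_Rcontinuous_scale (R : realType) (c a : R) (f : R -> R) :
  derivable_oy_Rcontinuous f a ->
  derivable_oy_Rcontinuous (fun t => c * f t) a.
Proof.
move=> [df f_cvg]; split=> [t t_gt|]; first exact/derivableZ/df.
exact: cvgZl_tmp f_cvg.
Qed.

Lemma rquot0_scale (R : realType) (c : R) (f : R -> R) :
  rquot0 (fun t => c * f t) = fun h => c * rquot0 f h.
Proof. by apply/funext => h; rewrite /rquot0; ring. Qed.

(** Differentiation is linear, so equation [k] is [c] times equation [i]. The fields need to be
    related only along the two trajectories. *)
Lemma first_order_solution_scale (R : realType) (n p : nat)
    (F : ('I_n -> R) -> 'I_n -> R) (G : ('I_p -> R) -> 'I_p -> R)
    (x0 : 'I_n -> R) (x : 'I_n -> R -> R) (y : 'I_p -> R -> R) :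
  (forall k, exists (i : 'I_n) (c : R), (y k = fun t => c * x i t) /\
     forall t, G (y ^~ t) k = c * F (x ^~ t) i) ->
  first_order_solution F x0 x ->
  first_order_solution G (fun k => y k 0) y.
Proof.
move=> yE [x_reg x_ode _]; split=> // [k|k t t_gt0];
  have [i [c [ykE GE]]] := yE k.
  by rewrite ykE; exact: derivable_oy_Rcontinuous_scale.
have [dx _] := x_reg i.
rewrite GE -x_ode // ykE derive1Ml //.
by apply: dx; rewrite in_itv /= t_gt0.
Qed.

Lemma inertial_solution_scale (R : realType) (n p : nat) (m : R)
    (F : ('I_n -> R) -> 'I_n -> R) (G : ('I_p -> R) -> 'I_p -> R)
    (x0 v0 : 'I_n -> R) (x : 'I_n -> R -> R) (y : 'I_p -> R -> R) :
  (forall k, exists (i : 'I_n) (c : R), (y k = fun t => c * x i t) /\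
     forall t, G (y ^~ t) k = c * F (x ^~ t) i) ->
  inertial_solution m F x0 v0 x ->
  inertial_solution m G (fun k => y k 0) (fun k => rderive0 (y k)) y.
Proof.
move=> yE [x_reg x_ode _ _].
have d1E i c (t : R) : 0 < t ->
    (fun s => c * x i s)^`()%classic t = c * (x i)^`()%classic t.
  move=> t_gt0; have [[dx _] _ _ _] := x_reg i.
  by rewrite derive1Ml //; apply: dx; rewrite in_itv /= t_gt0.
(* [d1E] holds at positive times only, so differentiating it once more calls for equality on a
   neighbourhood of [t]. *)
have d1E_near i c (t : R) : 0 < t ->
    (\forall s \near t,
      c * (x i)^`()%classic s = (fun s => c * x i s)^`()%classic s).
  by move=> t_gt0; near=> s; rewrite d1E //; near: s; exact: lt_nbhsr.
split=> // [k|k t t_gt0]; have [i [c [ykE GE]]] := yE k;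
  have [x_oy x_rq dx' x'_cvg] := x_reg i.
  rewrite ykE; split=> [||t t_gt0|].
  - exact: derivable_oy_Rcontinuous_scale.
  - by rewrite rquot0_scale; exact: is_cvgZl_tmp x_rq.
  - apply: near_eq_derivable (d1E_near i c t t_gt0) _.
    exact/derivableZ/dx'.
  - rewrite /rderive0 rquot0_scale.
    have -> : lim ((fun h => c * rquot0 (x i) h) @ 0^'+)%classic =
        c * lim (rquot0 (x i) @ 0^'+)%classic by exact: limZl_tmp.
    (* The filter [0^'+] sees positive times only, where [d1E] applies. *)
    apply: cvg_trans (cvgZl_tmp x'_cvg).
    apply: near_eq_cvg; near=> s; rewrite /= d1E //.
rewrite GE -x_ode // ykE d1E // derive1nS.
rewrite !derive1E -(near_eq_derive _ (d1E_near i c t t_gt0)) deriveZ.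
  by rewrite -!derive1E /GRing.scale /=; ring.
exact: dx'.
Unshelve. all: by end_near.
Qed.

Theorem lemma3p3 (R : realType) (N : nat) (N_ge1 : (1 <= N)%N)
    (nu : 'I_N -> R) (kappa : R) (kappa_ge0 : 0 <= kappa) :
  (forall (m : R) (Theta0 Omega0 : 'I_N -> R) (Theta : 'I_N -> R -> R),
     0 < m ->
     winfree2 m nu kappa Theta0 Omega0 Theta ->
     kuramoto2 m (lift4 nu) (2 * kappa)
       (fun k => Phi Theta k 0) (fun k => rderive0 (Phi Theta k)) (Phi Theta))
  /\
  (forall (Theta0 : 'I_N -> R) (Theta : 'I_N -> R -> R),
     winfree1 nu kappa Theta0 Theta ->
     kuramoto1 (lift4 nu) (2 * kappa) (fun k => Phi Theta k 0) (Phi Theta)).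
Proof.
have PhiE (Theta : 'I_N -> R -> R) (k : 'I_(4 * N)) :
    exists (i : 'I_N) (c : R), (Phi Theta k = fun t => c * Theta i t) /\
      forall t, kuramoto_field (lift4 nu) (2 * kappa) (Phi Theta ^~ t) k =
                c * winfree_field nu kappa (Theta ^~ t) i.
  have [i [c _ lift4E]] := lift4_scale R N k.
  exists i, c; split=> [|t]; first by apply/funext => t; rewrite /Phi lift4E.
  (* The scaling is applied a second time, now to the Winfree field as a vector. *)
  by rewrite -lift4E -kuramoto_field_lift4.
split=> [m Theta0 Omega0 Theta _|Theta0 Theta].
  exact: inertial_solution_scale.
exact: first_order_solution_scale.
Qed.
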